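(* Let $D\in[4,\infty)$. Let $G=(V,w,m)$ be a normalized linear graph with $V=I\cap\mathbb{Z}$ for an interval $I$, $\inf V\le 0$ and $\sup V=\infty$, and suppose $G$ satisfies $\mathrm{CD}(0,D)$. Then $$\frac{m(j)}{m(i)}\le\left(\frac{j+1}{i+1}\right)^{D-2}$$ for all $i,j\in\mathbb{N}_0$ with $j>i$. Furthermore, $p:=d_+-\frac12$ is non-negative on $V$ and $m$ is non-decreasing. Moreover the exponent $D-2$ is optimal: for every $D\in[4,\infty)$ and every $D'<D$ there is a normalized linear graph $G=(V,w,m)$ with $V=I\cap\mathbb{Z}$ for an interval $I$, $\inf V\le 0$ and $\sup V=\infty$, satisfying $\mathrm{CD}(0,D)$, for which the inequality $\frac{m(j)}{m(i)}\le\left(\frac{j+1}{i+1}\right)^{D'-2}$ fails for some $i,j\in\mathbb{N}_0$ with $j>i$.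
   Context: A weighted graph $G=(V,E,w,m)$ is a connected, undirected, simple, locally finite graph $(V,E)$ with vertex weights $m:V\to(0,\infty)$ and symmetric edge weights $w:E\to(0,\infty)$, $w(x,y)=w(y,x)$ (with $w(x,y)=0$ if $x\not\sim y$). It is normalized if $m(x)=\sum_{y\sim x}w(x,y)$ for all $x\in V$. It is a linear graph if $V=\mathbb{Z}\cap I$ for a (bounded or unbounded) interval $I\subset\mathbb{R}$ and $E=\{\{n,n+1\}: n,n+1\in V\}$. For a linear graph write $d_+(n)=w(n,n+1)/m(n)$. The Laplacian is $\Delta f(x)=\frac1{m(x)}\sum_{y\sim x}w(x,y)(f(y)-f(x))$ for $f:V\to\mathbb{R}$. Set $\Gamma(f,g)=\frac12(\Delta(fg)-f\Delta g-g\Delta f)$, $\Gamma(f)=\Gamma(f,f)$, and $\Gamma_2(f)=\frac12\Delta\Gamma(f)-\Gamma(f,\Delta f)$. For $K\in\mathbb{R}$, $D\in(0,\infty]$ (with $1/\infty=0$) and $x\in V$, the condition $\mathrm{CD}(K,D,x)$ means $\Gamma_2(f)(x)\ge\frac1D(\Delta f(x))^2+K\,\Gamma(f)(x)$ for all $f:V\to\mathbb{R}$; $\mathrm{CD}(K,D)$ means that $\mathrm{CD}(K,D,x)$ holds for all $x\in V$. *)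

(* Defs.v *)
From mathcomp Require Import all_boot all_order all_algebra.
From mathcomp Require Import all_classical all_reals all_analysis.

Set Implicit Arguments.
Unset Strict Implicit.
Unset Printing Implicit Defensive.

Import Order.TTheory GRing.Theory Num.Theory.

Local Open Scope classical_set_scope.
Local Open Scope ring_scope.

(* The vertices form a set in an ambient type T.  Weights and functions are
   total on T, but since edges join vertices only, every quantity below taken
   at a vertex depends only on values at vertices; quantifying over
   f : T -> R is thus the same as quantifying over functions on the vertices. *)
Record wgraph (R : realType) (T : choiceType) := WGraph {
  vert : set T;
  adj : rel T;
  vweight : T -> R;
  eweight : T -> T -> R;
  adj_vert : forall x y, adj x y -> vert x /\ vert y;
  adj_sym : symmetric adj;
  adj_irr : irreflexive adj;
  adj_locally_finite : forall x, vert x -> finite_set [set y | adj x y];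
  adj_connected : forall x y, vert x -> vert y ->
    exists2 p : seq T, path adj x p & last x p = y;
  vweight_gt0 : forall x, vert x -> 0 < vweight x;
  eweight_gt0 : forall x y, adj x y -> 0 < eweight x y;
  eweight_eq0 : forall x y, ~~ adj x y -> eweight x y = 0;
  eweight_sym : forall x y, eweight x y = eweight y x }.

Section Curvature.
Variables (R : realType) (T : choiceType) (G : wgraph R T).
Implicit Types (f g : T -> R) (x : T) (K : R) (D : \bar R).

Definition normalized : Prop := forall x, vert G x ->
  vweight G x = \sum_(y \in [set y | adj G x y]) eweight G x y.

Definition laplacian f : T -> R := fun x =>
  (vweight G x)^-1 *
    \sum_(y \in [set y | adj G x y]) eweight G x y * (f y - f x).

Definition Gamma f g : T -> R := fun x =>
  2^-1 * (laplacian (fun y => f y * g y) x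
          - f x * laplacian g x - g x * laplacian f x).

Definition Gamma2 f : T -> R := fun x =>
  2^-1 * laplacian (Gamma f f) x - Gamma f (laplacian f) x.

(* 1 / D for D in ]0, +oo], with 1 / +oo = 0; junk value at -oo *)
Definition inv_dim D : R := if D is d%:E then d^-1 else 0.

Definition CD_at K D x : Prop := forall f,
  inv_dim D * laplacian f x ^+ 2 + K * Gamma f f x <= Gamma2 f x.

Definition CD K D : Prop := forall x, vert G x -> CD_at K D x.

End Curvature.

Section LinearGraph.
Variables (R : realType) (G : wgraph R int).

Definition linear_graph : Prop :=
  (exists I : interval R, vert G = [set n : int | n%:~R \in I]) /\
  (forall n k : int, adj G n k <->
     [/\ vert G n, vert G k & k = n + 1 \/ n = k + 1]).

Definition inf_vert : \bar R := ereal_inf [set (n%:~R : R)%:E | n in vert G].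

Definition sup_vert : \bar R := ereal_sup [set (n%:~R : R)%:E | n in vert G].

Definition dplus (n : int) : R := eweight G n (n + 1) / vweight G n.

Definition growth_bound (d : R) (i j : nat) : Prop :=
  vweight G j%:Z / vweight G i%:Z <= (j.+1%:R / i.+1%:R) `^ (d - 2).

End LinearGraph.

(* Main.v *)
(* With q = d_+, r = d_-, p = q - 1/2 and th = 1 - 2/D, minimizing Gamma_2 over
   the values of f at distance two from n turns CD(0, D, n) into the
   nonnegativity of a binary quadratic form in the slopes of f on both sides of
   n; for interior n its discriminant condition reads
     2 p(n-1) p(n+1) <= th (q(n) p(n-1) - r(n) p(n+1)),
   a discrete version of the Riccati inequality p' <= - 4 p^2 / (D - 2).  A
   negative value of p would therefore blow up to the right, which is impossible
   as p > -1/2, and comparison with the solution p(n) = k / (2 (k + n)),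
   k = (D - 2) / 2, which starts at p(0) = 1/2, bounds
   m(n+1) / m(n) = q(n) / r(n+1) by (n + 2k)(n + 1 + k) / ((n + k)(n + 1)).
   This is at most ((n + 2) / (n + 1))^(2k) when k >= 1, and it is attained by
   the half-line whose drift is that solution; since it is 1 + 2k/n + o(1/n), no
   smaller exponent works. *)
Require Import Defs.
From mathcomp Require Import all_boot all_order all_algebra.
From mathcomp Require Import all_classical all_reals all_analysis.
From mathcomp Require Import ring lra zify.
Set Implicit Arguments.
Unset Strict Implicit.
Unset Printing Implicit Defensive.
Import Order.TTheory GRing.Theory Num.Theory.
Local Open Scope classical_set_scope.
Local Open Scope ring_scope.

(** * Binary quadratic forms, and the Archimedean source of contradictions *)

Lemma quadratic_form_discr (R : realFieldType) (A B C : R) :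
  (forall a b, 0 <= A * a ^+ 2 - 2 * C * a * b + B * b ^+ 2) ->
  C ^+ 2 <= A * B.
Proof.
move=> Q.
have A0 : 0 <= A by have := Q 1 0; lra.
have [AE|A_neq0] := eqVneq A 0.
  (* When [A = 0], the form takes the value [- 4 * C ^+ 2] at this point. *)
  have := Q (B + 1) (2 * C); rewrite AE !mul0r => h; suff: 0 <= - 4 * C ^+ 2 by lra.
  apply: le_trans h _; rewrite le_eqVlt; apply/orP; left; apply/eqP; ring.
have Agt0 : 0 < A by rewrite lt_def A_neq0.
have := Q C A.
have -> : A * C ^+ 2 - 2 * C * C * A + B * A ^+ 2 = A * (A * B - C ^+ 2) by ring.
by rewrite pmulr_rge0 // subr_ge0.
Qed.

Lemma quadratic_form_ge0 (R : realFieldType) (A B C : R) :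
  0 < A -> C ^+ 2 <= A * B ->
  forall a b, 0 <= A * a ^+ 2 - 2 * C * a * b + B * b ^+ 2.
Proof.
move=> A0 disc a b; rewrite -(pmulr_rge0 _ A0).
have -> : A * (A * a ^+ 2 - 2 * C * a * b + B * b ^+ 2) =
  (A * a - C * b) ^+ 2 + (A * B - C ^+ 2) * b ^+ 2 by ring.
by apply: addr_ge0; rewrite ?sqr_ge0 // mulr_ge0 ?sqr_ge0 // subr_ge0.
Qed.

(** Discrete substitute for blow-up in finite time: [drift_ge0] applies it to positive quantities
    built from the reciprocals of a negative drift. *)
Lemma no_steady_decrease (R : archiRealFieldType) (Y : nat -> R) (c : R) :
  0 < c -> (forall i, 0 < Y i) -> ~ (forall i, Y i.+1 <= Y i - c).
Proof.
move=> c0 Y0 Yc.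
have Yi i : Y i <= Y 0%N - i%:R * c.
  elim: i => [|i IH]; first by lra.
  by have := Yc i; rewrite -natr1; lra.
have := truncnS_gt (Y 0%N / c).
rewrite ltr_pdivrMr // => Yb.
have := Yi (Num.truncn (Y 0%N / c)).+1.
by have := Y0 (Num.truncn (Y 0%N / c)).+1; lra.
Qed.

(** * The discrete Riccati inequality forces a nonnegative drift *)

Section DriftSequence.
Variables (R : archiRealFieldType) (th : R) (p : nat -> R).
Hypotheses (th0 : 0 < th) (th1 : th < 1).
Hypothesis p_lo : forall n, - 2^-1 < p n.
Hypothesis p_left : forall n, 0 <= th * (2^-1 - p n.+1) + 2 * p n.
Hypothesis p_step : forall n, 2 * p n * p n.+2 <=
  th * ((2^-1 + p n.+1) * p n - (2^-1 - p n.+1) * p n.+2).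

(** Collecting the terms in [p n.+2], the step inequality reads [p n.+2 * (th * (2^-1 - p n.+1) + 2
    * p n) <= th * (2^-1 + p n.+1) * p n]. The right side is negative, and [p_left] makes the factor
    on the left nonnegative. Negativity thus propagates within a parity class only. *)
Let neg2 n : p n < 0 -> p n.+2 < 0.
Proof.
move=> pn; have L := p_left n; have S := p_step n; have P := p_lo n.+1.
rewrite ltNge; apply/negP => p2.
have h1 : 0 <= p n.+2 * (th * (2^-1 - p n.+1) + 2 * p n) by rewrite mulr_ge0.
have h2 : th * (2^-1 + p n.+1) * p n < 0 by rewrite nmulr_llt0 // mulr_gt0 //; lra.
lra.
Qed.

(** For [p n.+1 >= 0] the mixed terms of the step inequality have a favourable sign, and [th < 1]
    leaves [4 * (p n * p n.+2) <= p n - p n.+2]; dividing by the positive product gives the drop. *)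
Let inv_drop n : p n < 0 -> 0 <= p n.+1 -> - (p n.+2)^-1 <= - (p n)^-1 - 4.
Proof.
move=> pn p1; have p2 := neg2 pn; have S := p_step n.
have : 4 * (p n * p n.+2) <= p n - p n.+2.
  have pp : 0 < p n * p n.+2 by rewrite nmulr_lgt0.
  have h : 2 * p n * p n.+2 <= th * (2^-1 * (p n - p n.+2)).
    have : 0 <= th * p n.+1 * - (p n + p n.+2).
      apply: mulr_ge0; last by lra.
      by apply: mulr_ge0 => //; apply: ltW.
    lra.
  have : 0 < th * (2^-1 * (p n - p n.+2)) by lra.
  rewrite pmulr_rgt0 // => d0.
  have : 0 <= (1 - th) * (2^-1 * (p n - p n.+2)).
    by apply: mulr_ge0; have t1 := th1; lra.
  lra.
have pp : 0 < p n * p n.+2 by rewrite nmulr_lgt0.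
rewrite -ler_pdivlMr // mulrBl.
have n0 := ltr0_neq0 pn; have n2 := ltr0_neq0 p2.
have -> : p n / (p n * p n.+2) - p n.+2 / (p n * p n.+2) = (p n.+2)^-1 - (p n)^-1.
  by field; rewrite n0 n2.
lra.
Qed.

(* With t = -1/p the step inequality reads
     t(n+2) (t(n+1) - 2) <= t(n) (t(n+1) + 2) - (4 / th) t(n+1),
   so the energy drops by at least 4 (1/th - 1) t(n+1), where t(n+1) > 2. *)
Let energy n := let t i := - (p i)^-1 in t n.+1 * (t n - 2) + 2 * t n.

Let energy_drop n : p n < 0 -> p n.+1 < 0 -> p n.+2 < 0 ->
  energy n.+1 <= energy n - 8 * (th^-1 - 1).
Proof.
move=> p0 p1 p2; have S := p_step n; rewrite /energy /=.
have i0 : (- p n)^-1 > 0 by rewrite invr_gt0; lra.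
have i1 : (- p n.+1)^-1 > 0 by rewrite invr_gt0; lra.
have i2 : (- p n.+2)^-1 > 0 by rewrite invr_gt0; lra.
have t1 : 2 < (- p n.+1)^-1.
  by rewrite -[2]invrK ltf_pV2 ?posrE; have := p_lo n.+1; lra.
have n0 := ltr0_neq0 p0; have n1 := ltr0_neq0 p1; have n2 := ltr0_neq0 p2.
rewrite -!invrN.
set x := (- p n)^-1 in i0 *; set y := (- p n.+1)^-1 in i1 t1 *.
set z := (- p n.+2)^-1 in i2 *.
have xE : p n = - x^-1 by rewrite /x invrK opprK.
have yE : p n.+1 = - y^-1 by rewrite /y invrK opprK.
have zE : p n.+2 = - z^-1 by rewrite /z invrK opprK.
have tn0 : th != 0 by rewrite gt_eqF.
have key : z * (y - 2) <= x * (y + 2) - 4 * th^-1 * y.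
  have xn := lt0r_neq0 i0; have yn := lt0r_neq0 i1; have zn := lt0r_neq0 i2.
  (* Multiplying the step inequality by this factor clears all reciprocals. *)
  have w0 : 0 <= 2 * th^-1 * x * y * z by rewrite ltW // !mulr_gt0 // invr_gt0.
  have := ler_wpM2l w0 S; rewrite xE yE zE.
  have -> : 2 * th^-1 * x * y * z * (2 * - x^-1 * - z^-1) = 4 * th^-1 * y.
    by field; rewrite xn zn tn0.
  have -> : 2 * th^-1 * x * y * z *
    (th * ((2^-1 - y^-1) * - x^-1 - (2^-1 - - y^-1) * - z^-1)) =
     x * (y + 2) - z * (y - 2).
    by field; rewrite xn yn zn tn0.
  lra.
have : 0 <= (th^-1 - 1) * (y - 2).
  by rewrite mulr_ge0 ?subr_ge0 ?invf_ge1 // ltW.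
lra.
Qed.

(** If [p 0] is negative, so is every even term. Either all odd terms are nonnegative, and [- 1 / p]
    along the even indices decreases steadily, or some odd term is negative, all terms from there on
    are negative, and [energy] decreases steadily. Both quantities are positive, a contradiction. *)
Lemma drift_ge0 : 0 <= p 0%N.
Proof.
rewrite leNgt; apply/negP => p0.
have even i : p i.*2 < 0 by elim: i => [//|i IH]; rewrite doubleS; apply: neg2.
have [odd_ge0|/existsNP[m /negP]] := pselect (forall i, 0 <= p i.*2.+1).
  apply: (@no_steady_decrease R (fun i => - (p i.*2)^-1) 4) => // i.
    by rewrite oppr_gt0 invr_lt0.
  by rewrite doubleS; apply: inv_drop.
rewrite -ltNge => pm.
have all_neg i : p (m.*2 + i)%N < 0 /\ p (m.*2 + i).+1 < 0.
  elim: i => [|i [h1 h2]]; first by rewrite addn0.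
  by rewrite addnS; split => //; apply: neg2.
apply: (@no_steady_decrease R (fun i => energy (m.*2 + i)%N) (8 * (th^-1 - 1))).
- by rewrite mulr_gt0 // subr_gt0 invf_gt1.
- move=> i; have [h1 h2] := all_neg i; rewrite /energy.
  have t0 : 2 < - (p (m.*2 + i)%N)^-1.
    by rewrite -invrN -[2]invrK ltf_pV2 ?posrE; have := p_lo (m.*2 + i)%N; lra.
  have t1 : 0 < - (p (m.*2 + i).+1)^-1 by rewrite oppr_gt0 invr_lt0.
  have : 0 < - (p (m.*2 + i).+1)^-1 * (- (p (m.*2 + i)%N)^-1 - 2).
    by rewrite mulr_gt0 // subr_gt0.
  lra.
- move=> i; have [h1 h2] := all_neg i; have [_ h3] := all_neg i.+1.
  by rewrite addnS in h3 *; apply: energy_drop.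
Qed.

End DriftSequence.

(** * Comparison with the extremal drift *)

Section DriftBound.
Variables (R : realFieldType) (k : R).
Hypothesis k0 : 0 < k.

Definition extremal_drift (n : nat) : R := k / (2 * (k + n%:R)).

Lemma extremal_drift_gt0 n : 0 < extremal_drift n.
Proof.
by rewrite divr_gt0 // mulr_gt0 // ltr_wpDr.
Qed.

Lemma extremal_drift_lt n : extremal_drift n.+1 < 2^-1.
Proof.
rewrite ltr_pdivrMr; last by rewrite mulr_gt0 // ltr_wpDr.
have := ltr0Sn R n; lra.
Qed.

(** The discrete Riccati inequality is an equality here; [k / (k + 1)] is [1 - 2 / D] for
    [D = 2 * k + 2]. *)
Lemma extremal_drift_step n :
  let e := extremal_drift in
  k / (k + 1) * ((2^-1 + e n.+1) * e n - (2^-1 - e n.+1) * e n.+2) =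
  2 * e n * e n.+2.
Proof.
rewrite /= /extremal_drift -!natr1; have := ler0n R n => n0.
by have kp := k0; field; repeat (apply/andP; split); apply: lt0r_neq0; lra.
Qed.

(** Solved for [p n.+2], the step inequality has the upper bound [th * (2^-1 + p n.+1) * p n / (2 *
    p n + th * (2^-1 - p n.+1))], nondecreasing in both earlier terms. Induction on two consecutive
    terms therefore preserves the comparison; it starts from the extremal values [1 / 2] and
    [th / 2]. *)
Lemma drift_le_extremal (p : nat -> R) :
  let th := k / (k + 1) in
  (forall n, 0 <= p n) -> (forall n, p n.+1 < 2^-1) ->
  p 0%N <= 2^-1 -> p 1%N <= th / 2 ->
  (forall n, 2 * p n * p n.+2 <=
    th * ((2^-1 + p n.+1) * p n - (2^-1 - p n.+1) * p n.+2)) ->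
  forall n, p n <= extremal_drift n.
Proof.
move=> th pge0 plt p0 p1 step n.
have th0 : 0 < th by rewrite divr_gt0 // ltr_wpDr.
suff: p n <= extremal_drift n /\ p n.+1 <= extremal_drift n.+1 by case.
elim: n => [|n [IH0 IH1]].
  split; rewrite /extremal_drift.
    have -> : k / (2 * (k + 0%:R)) = 2^-1; last by [].
    by field; have kp := k0; rewrite ?lt0r_neq0 //; lra.
  have -> : k / (2 * (k + 1%:R)) = th / 2; last by [].
  by rewrite /th; field; have kp := k0; rewrite ?lt0r_neq0 //; lra.
split=> //.
have S := step n; have E := extremal_drift_step n; rewrite /= -/th in E.
have e0 := extremal_drift_gt0 n; have e2 := extremal_drift_gt0 n.+2.
have el := extremal_drift_lt n; have pl := plt n; have pg := pge0 n.
set e := extremal_drift n in IH0 E e0; set f := extremal_drift n.+1 in IH1 E el.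
set g := extremal_drift n.+2 in E e2 *.
(* By [E], the product of [e] with this quantity is [th * (2^-1 - f) * g], which is positive. Its
   sign is what allows [p n] to be replaced by [e]. *)
have cf : 0 < th * (2^-1 + f) - 2 * g.
  rewrite -(pmulr_rgt0 _ e0).
  have : 0 < th * (2^-1 - f) * g.
    by apply: mulr_gt0 => //; apply: mulr_gt0 => //; rewrite subr_gt0.
  lra.
have h1 : p n * (th * (2^-1 + f) - 2 * g) <= e * (th * (2^-1 + f) - 2 * g).
  by rewrite ler_pM2r.
have h2 : th * p n * p n.+1 <= th * p n * f.
  by rewrite ler_wpM2l //; apply: mulr_ge0 => //; apply: ltW.
have h3 : th * g * p n.+1 <= th * g * f.
  by rewrite ler_wpM2l //; apply: mulr_ge0; apply: ltW.
have c0 : 0 < 2 * p n + th * (2^-1 - p n.+1).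
  by rewrite ltr_wpDl ?mulr_ge0 //; apply: mulr_gt0 => //; rewrite subr_gt0.
rewrite -(ler_pM2r c0); lra.
Qed.

End DriftBound.

(** * The curvature condition on a linear graph *)

Section LinearCurvature.
Variables (R : realType) (G : wgraph R int).
Hypothesis linG : linear_graph G.

Definition dminus (n : int) : R := eweight G n (n - 1) / vweight G n.

(** Both integer neighbours may be listed even at an endpoint, since [eweight] vanishes off the
    edges. *)
Lemma linear_sum_adj (n : int) (F : int -> R) :
  \sum_(y \in [set y | adj G n y]) eweight G n y * F y =
  eweight G n (n - 1) * F (n - 1) + eweight G n (n + 1) * F (n + 1).
Proof.
rewrite (fsbig_widen _ [set n - 1; n + 1]).
- rewrite fsbigU0 ?fsbig_set1 //= => y [/= -> h]; lia.
- by move=> y /= /(linG.2 _ _).1[_ _ [->|->]]; [right|left => /=; lia].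
- by move=> y /= [_ /negP nadj]; rewrite eweight_eq0 ?mul0r.
Qed.

Lemma linear_laplacian f n : laplacian G f n =
  dminus n * (f (n - 1) - f n) + dplus G n * (f (n + 1) - f n).
Proof.
by rewrite /laplacian (linear_sum_adj n (fun y => f y - f n)) /dminus /dplus; ring.
Qed.

Lemma linear_Gamma f g n : Gamma G f g n = 2^-1 *
  (dminus n * (f (n - 1) - f n) * (g (n - 1) - g n) +
   dplus G n * (f (n + 1) - f n) * (g (n + 1) - g n)).
Proof. by rewrite /Gamma !linear_laplacian; ring. Qed.

Lemma dplus_ge0 n : vert G n -> 0 <= dplus G n.
Proof.
move=> Vn; rewrite divr_ge0 ?(ltW (vweight_gt0 Vn)) //.
by have [/eweight_gt0/ltW//|/eweight_eq0->] := boolP (adj G n (n + 1)).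
Qed.

Lemma dminus_ge0 n : vert G n -> 0 <= dminus n.
Proof.
move=> Vn; rewrite divr_ge0 ?(ltW (vweight_gt0 Vn)) //.
by have [/eweight_gt0/ltW//|/eweight_eq0->] := boolP (adj G n (n - 1)).
Qed.

Lemma dplus_gt0 n : vert G n -> vert G (n + 1) -> 0 < dplus G n.
Proof.
move=> Vn Vn1; rewrite divr_gt0 ?vweight_gt0 // eweight_gt0 //.
by apply: (linG.2 _ _).2; split => //; left.
Qed.

Lemma dminus_gt0 n : vert G n -> vert G (n - 1) -> 0 < dminus n.
Proof.
move=> Vn Vn1; rewrite divr_gt0 ?vweight_gt0 // eweight_gt0 //.
by apply: (linG.2 _ _).2; split => //; right; lia.
Qed.

Lemma dplus_eq0 n : ~ vert G (n + 1) -> dplus G n = 0.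
Proof.
move=> nV; rewrite /dplus eweight_eq0 ?mul0r //.
by apply/negP => /adj_vert[].
Qed.

Lemma dminus_eq0 n : ~ vert G (n - 1) -> dminus n = 0.
Proof.
move=> nV; rewrite /dminus eweight_eq0 ?mul0r //.
by apply/negP => /adj_vert[].
Qed.

(** Detailed balance: both sides are the weight of the edge joining [n] and [n + 1]. *)
Lemma eweight_dplus_dminus n : vert G n -> vert G (n + 1) ->
  dplus G n * vweight G n = dminus (n + 1) * vweight G (n + 1).
Proof.
move=> Vn Vn1; rewrite /dplus /dminus !divfK ?lt0r_neq0 ?vweight_gt0 //.
by rewrite addrK eweight_sym.
Qed.

Hypothesis normG : normalized G.

Lemma dminus_dplus1 n : vert G n -> dminus n + dplus G n = 1.
Proof.
move=> Vn; have m0 := lt0r_neq0 (vweight_gt0 Vn).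
rewrite /dminus /dplus -mulrDl; apply: (canLR (mulfK m0)); rewrite mul1r.
rewrite (normG Vn); have := linear_sum_adj n (fun=> 1); rewrite !mulr1 => <-.
by apply: eq_fsbigr => y _; rewrite mulr1.
Qed.

(** [4 * (Gamma2 - laplacian ^ 2 / D)] at [n] for a function with constant slope [a] to the left of
    [n] and [b] to the right. *)
Definition curvature_form (D : R) (n : int) (a b : R) : R :=
  (2 - 4 / D) * (dplus G n * b - dminus n * a) ^+ 2 +
  dplus G n * (3 * dminus (n + 1) - dplus G (n + 1) - 1) * b ^+ 2 +
  dminus n * (3 * dplus G (n - 1) - dminus (n - 1) - 1) * a ^+ 2.

(* The value of [f] at distance two from [n] enters the curvature only through
   the last two squares, which vanish when the slope of [f] is constant on
   each side of [n]. *)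
Lemma linear_Gamma2 (D : R) f n : vert G n ->
  let a := f n - f (n - 1) in let b := f (n + 1) - f n in
  4 * (Gamma2 G f n - D^-1 * laplacian G f n ^+ 2) =
  curvature_form D n a b +
  dplus G n * dplus G (n + 1) * (f (n + 1 + 1) - f (n + 1) - b) ^+ 2 +
  dminus n * dminus (n - 1) * (f (n - 1) - f (n - 1 - 1) - a) ^+ 2.
Proof.
move=> Vn /=; rewrite /Gamma2 !linear_laplacian !linear_Gamma !linear_laplacian.
rewrite /curvature_form !subrK !addrK.
have := dminus_dplus1 Vn.
move: (dminus n) (dplus G n) (dminus (n + 1)) (dplus G (n + 1)) (dminus (n - 1))
  (dplus G (n - 1)) => r q r1 q1 r2 q2 nE.
move: (f n) (f (n + 1)) (f (n + 1 + 1)) (f (n - 1)) (f (n - 1 - 1)) => x y z u v.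
have -> : r = 1 - q by lra.
by move: (D^-1) => d; field.
Qed.

(** The test function is piecewise linear with its only kink at [n], so the two extra squares of
    [linear_Gamma2] vanish. *)
Lemma CD_at_curvature_form (D : R) n a b : vert G n ->
  CD_at G 0 D%:E n -> 0 <= curvature_form D n a b.
Proof.
move=> Vn /(_ (fun i : int => (i - n)%:~R * (if n <= i then b else a))).
set f := fun i : int => _.
rewrite mul0r addr0 -subr_ge0 -(pmulr_rge0 _ (ltr0Sn R 3)) linear_Gamma2 //.
have fS (i : int) : f (n + i) = i%:~R * (if 0 <= i then b else a).
  by rewrite /f addrAC subrr add0r lerDl.
have f0 : f n = 0 by rewrite /f subrr mul0r.
have -> : f (n + 1 + 1) = 2 * b by rewrite -addrA fS.
have -> : f (n + 1) = b by rewrite fS mul1r.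
have -> : f (n - 1 - 1) = - 2 * a by rewrite -addrA fS.
have -> : f (n - 1) = - a by rewrite fS mulN1r.
rewrite f0 => /le_trans; apply; rewrite le_eqVlt; apply/orP; left; apply/eqP.
rewrite !(subr0, sub0r, opprK).
ring.
Qed.

Lemma curvature_form_CD_at (D : R) n : vert G n ->
  (forall a b, 0 <= curvature_form D n a b) -> CD_at G 0 D%:E n.
Proof.
move=> Vn Q f; rewrite mul0r addr0 -subr_ge0 -(pmulr_rge0 _ (ltr0Sn R 3)).
rewrite linear_Gamma2 //; apply: addr_ge0; first apply: addr_ge0 => //.
  apply: mulr_ge0; last exact: sqr_ge0.
  have [V|V] := pselect (vert G (n + 1)); last by rewrite dplus_eq0 // mul0r.
  by rewrite mulr_ge0 ?dplus_ge0.
apply: mulr_ge0; last exact: sqr_ge0.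
have [V|V] := pselect (vert G (n - 1)); last by rewrite dminus_eq0 // mul0r.
by rewrite mulr_ge0 ?dminus_ge0.
Qed.

(** Normalization eliminates [dminus] at the two neighbours. The disjunction admits a left endpoint,
    where the terms in [a] vanish with [dminus n]. *)
Lemma curvature_form_drift (D : R) n a b :
  let th := 1 - 2 / D in let p i := dplus G i - 2^-1 in
  vert G (n + 1) -> vert G (n - 1) \/ dminus n = 0 ->
  curvature_form D n a b = 2 * (th * (dplus G n * b - dminus n * a) ^+ 2
    - 2 * dplus G n * p (n + 1) * b ^+ 2
    + 2 * dminus n * p (n - 1) * a ^+ 2).
Proof.
move=> th p V1 V2; rewrite /curvature_form /th /p.
have E1 := dminus_dplus1 V1.
have -> : dminus (n + 1) = 1 - dplus G (n + 1) by lra.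
have [V|->] := V2; last by rewrite !mul0r; move: (D^-1) => d; field.
have E2 := dminus_dplus1 V.
have -> : dminus (n - 1) = 1 - dplus G (n - 1) by lra.
by move: (D^-1) => d; field.
Qed.

Section CurvatureConsequences.
Variables (D : R) (n : int).
Hypotheses (Vn : vert G n) (CDn : CD_at G 0 D%:E n).

Let th := 1 - 2 / D.
Let drift i := dplus G i - 2^-1.

(** The form at slopes [(0, 1)]; a left endpoint [n] is allowed. *)
Lemma CD_drift_right : vert G (n + 1) ->
  2 * drift (n + 1) <= th * dplus G n.
Proof.
move=> V1; have q0 := dplus_gt0 Vn V1.
have V2 : vert G (n - 1) \/ dminus n = 0.
  by have [V|/dminus_eq0 V] := pselect (vert G (n - 1)); [left|right].
have := CD_at_curvature_form 0 1 Vn CDn; rewrite curvature_form_drift //.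
have -> : 2 * (th * (dplus G n * 1 - dminus n * 0) ^+ 2
    - 2 * dplus G n * drift (n + 1) * 1 ^+ 2
    + 2 * dminus n * drift (n - 1) * 0 ^+ 2) =
    2 * dplus G n * (th * dplus G n - 2 * drift (n + 1)) by ring.
by rewrite pmulr_rge0 ?subr_ge0 //; apply: mulr_gt0.
Qed.

Lemma CD_drift_left : vert G (n - 1) -> vert G (n + 1) ->
  0 <= th * dminus n + 2 * drift (n - 1).
Proof.
move=> V0 V1; have r0 := dminus_gt0 Vn V0.
have := CD_at_curvature_form 1 0 Vn CDn.
rewrite curvature_form_drift //; last by left.
have -> : 2 * (th * (dplus G n * 0 - dminus n * 1) ^+ 2
    - 2 * dplus G n * drift (n + 1) * 0 ^+ 2
    + 2 * dminus n * drift (n - 1) * 1 ^+ 2) =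
    2 * dminus n * (th * dminus n + 2 * drift (n - 1)) by ring.
by rewrite pmulr_rge0 //; apply: mulr_gt0.
Qed.

(** The discriminant inequality of the form, divided by [2 * dminus n * dplus G n]. *)
Lemma CD_drift_step : vert G (n - 1) -> vert G (n + 1) ->
  2 * drift (n - 1) * drift (n + 1) <=
  th * (dplus G n * drift (n - 1) - dminus n * drift (n + 1)).
Proof.
move=> V0 V1; have r0 := dminus_gt0 Vn V0; have q0 := dplus_gt0 Vn V1.
have := @quadratic_form_discr R
  (dminus n * (th * dminus n + 2 * drift (n - 1)))
  (dplus G n * (th * dplus G n - 2 * drift (n + 1)))
  (th * dplus G n * dminus n).
set A := dminus n * _; set B := dplus G n * _; set C := th * _ * _ => disc.
have {}disc : C ^+ 2 <= A * B.
  apply: disc => a b; have := CD_at_curvature_form a b Vn CDn.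
  rewrite curvature_form_drift //; last by left.
  rewrite pmulr_rge0 //; congr (0 <= _); rewrite /= /A /B /C /th /drift; ring.
rewrite -subr_ge0 -(pmulr_rge0 _ (mulr_gt0 (mulr_gt0 r0 q0) (ltr0Sn R 1))).
move: disc; rewrite -subr_ge0; congr (0 <= _); rewrite /A /B /C; ring.
Qed.

End CurvatureConsequences.

End LinearCurvature.

(** * The extremal ratio of consecutive vertex weights and its power bounds *)

Section GrowthFactor.
Variables (R : realType) (k : R).
Hypothesis k1 : 1 <= k.

Definition growth_factor (n : nat) : R :=
  (n%:R + 2 * k) * (n%:R + 1 + k) / ((n%:R + k) * (n%:R + 1)).

Lemma growth_factor_drift n :
  (2^-1 + extremal_drift k n) / (2^-1 - extremal_drift k n.+1) = growth_factor n.
Proof.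
rewrite /extremal_drift /growth_factor -!natr1; have := ler0n R n.
move: (n%:R) => x x0; have kp := k1.
by field; repeat (apply/andP; split); apply: lt0r_neq0; lra.
Qed.

Lemma growth_factor_le n : growth_factor n <= (n.+2%:R / n.+1%:R) `^ (2 * k).
Proof.
rewrite /growth_factor -[n.+2%:R]natr1 -[n.+1%:R]natr1; have := ler0n R n.
move: (n%:R) => z z0; set y := (z + 1 + 1) / (z + 1); have kp := k1.
have x0 : 0 < z + 1 by lra.
have y0 : 0 < y by rewrite divr_gt0 //; lra.
have yV : y^-1 = 1 + - (z + 1 + 1)^-1.
  by rewrite /y; field; apply/andP; split; apply: lt0r_neq0; lra.
have x1V : (z + 1 + 1)^-1 < 1 by rewrite invf_lt1; lra.
have lny : (z + 1 + 1)^-1 <= ln y.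
  have : ln (1 + - (z + 1 + 1)^-1) <= - (z + 1 + 1)^-1 by apply: le_ln1Dx; lra.
  by rewrite -yV lnV ?posrE // lerN2.
have pw : 1 + 2 * (k - 1) / (z + 1 + 1) <= y `^ (2 * (k - 1)).
  rewrite /powR gt_eqF //; apply: le_trans (expR_ge1Dx _) _.
  by rewrite ler_expR ler_wpM2l // mulr_ge0 // subr_ge0.
have -> : y `^ (2 * k) = y ^+ 2 * y `^ (2 * (k - 1)).
  have -> : 2 * k = 2 + 2 * (k - 1) by ring.
  by rewrite powRD ?(gt_eqF y0) ?implybT // powR_mulrn // ltW.
refine (le_trans _ (ler_wpM2l (sqr_ge0 y) pw)).
have kz : 0 < z + k by lra.
have -> : y ^+ 2 * (1 + 2 * (k - 1) / (z + 1 + 1)) =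
    (z + 2 * k) * (z + 1 + 1) / ((z + 1) * (z + 1)).
  by rewrite /y; field; apply/andP; split; apply: lt0r_neq0; lra.
rewrite ler_pdivrMr ?mulr_gt0 // mulrAC ler_pdivlMr ?mulr_gt0 //.
rewrite -subr_ge0.
have -> : (z + 2 * k) * (z + 1 + 1) * ((z + k) * (z + 1)) -
    (z + 2 * k) * (z + 1 + k) * ((z + 1) * (z + 1)) =
    (z + 2 * k) * (z + 1) * (k - 1) by ring.
by rewrite !mulr_ge0 //; lra.
Qed.

(** With [x = n + 1] and [c = max(d, 0)], the power is at most [expR (c / x) <= x / (x - c)]. After
    clearing denominators the growth factor wins by a polynomial in [x] with leading term
    [(2 * k - c) * x ^ 2]. *)
Lemma growth_factor_gt d : d < 2 * k ->
  exists n : nat, (n.+2%:R / n.+1%:R) `^ d < growth_factor n.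
Proof.
move=> dk; have kp := k1.
pose c := Num.max d 0.
have c0 : 0 <= c by rewrite le_max lexx orbT.
have ck : c < 2 * k by rewrite gt_max dk; lra.
have dc : d <= c by rewrite le_max lexx.
(* [x > M] makes the quadratic term absorb the lower-order ones; adding [2 * k] below ensures
   [x > c]. *)
pose M := (6 * k ^+ 2 + 4 * k ^+ 3) / (2 * k - c).
exists (Num.truncn (M + 2 * k)).
have := truncnS_gt (M + 2 * k); set n := Num.truncn _.
rewrite /growth_factor -[n.+2%:R]natr1 -[n.+1%:R]natr1.
move: (n%:R) => z zM.
have kge0 : 0 <= k by lra.
have M0 : 0 <= M.
  apply: divr_ge0; last by lra.
  by have := exprn_ge0 2 kge0; have := exprn_ge0 3 kge0; lra.
have Mx : 6 * k ^+ 2 + 4 * k ^+ 3 < (z + 1) * (2 * k - c).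
  by rewrite -ltr_pdivrMr ?subr_gt0 // -/M; lra.
have [x zE] : exists x, z = x - 1 by exists (z + 1); rewrite addrK.
rewrite {}zE subrK in zM Mx *; rewrite addrC in zM.
have x0 : 0 < x by lra.
have lnx : ln ((x + 1) / x) <= x^-1.
  have -> : (x + 1) / x = 1 + x^-1 by field; rewrite gt_eqF.
  by apply: le_ln1Dx; rewrite (@lt_trans _ _ 0) ?invr_gt0 // ltrN10.
have lnx0 : 0 <= ln ((x + 1) / x).
  by rewrite ln_ge0 // ler_pdivlMr // mul1r; lra.
have y0 : 0 < (x + 1) / x by rewrite divr_gt0 //; lra.
have cx : 0 < 1 - c / x by rewrite subr_gt0 ltr_pdivrMr // mul1r; lra.
apply: (@le_lt_trans _ _ (1 - c / x)^-1).
  rewrite /powR gt_eqF //.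
  apply: (@le_trans _ _ (expR (c / x))).
    rewrite ler_expR; apply: (@le_trans _ _ (c * ln ((x + 1) / x))).
      by rewrite ler_wpM2r.
    by rewrite ler_wpM2l.
  rewrite -[leLHS]invrK lef_pV2 ?posrE ?invr_gt0 ?expR_gt0 // -expRN.
  by have := expR_ge1Dx (- (c / x)).
have -> : (1 - c / x)^-1 = x / (x - c).
  by field; rewrite !gt_eqF //; lra.
have xc : 0 < x - c by lra.
rewrite ltr_pdivrMr // mulrAC ltr_pdivlMr ?mulr_gt0 //; try lra.
rewrite -subr_gt0.
have h1 : 0 < x * (x * (2 * k - c) - (6 * k ^+ 2 + 4 * k ^+ 3)).
  by rewrite mulr_gt0 // subr_gt0.
have h2 : 0 <= x * ((2 * k - c) * (3 * k - 1)).
  by apply: mulr_ge0; [lra | apply: mulr_ge0; lra].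
have h3 : 0 <= (2 * k - c) * ((2 * k - 1) * k).
  by apply: mulr_ge0; [lra | apply: mulr_ge0; lra].
have h4 : 0 <= k ^+ 3 * (x - 1) by rewrite mulr_ge0 ?exprn_ge0 //; lra.
have h5 : 0 <= x * ((2 * k - 1) * k).
  by apply: mulr_ge0; [lra | apply: mulr_ge0; lra].
have h6 : 0 <= x * k by apply: mulr_ge0; lra.
have h7 := sqr_ge0 k.
lra.
Qed.

End GrowthFactor.

(** * The normalized half-line with prescribed edge weights *)

Section HalfLine.
Variables (R : realType) (w : nat -> R).
Hypothesis w0 : forall i, 0 < w i.

Definition halfline_adj : rel int := fun x y =>
  [&& 0 <= x, 0 <= y & (y == x + 1) || (x == y + 1)].

(** [w i] sits on the edge from [i] to [i + 1], indexed by its left end. *)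
Definition halfline_ew (x y : int) : R :=
  if halfline_adj x y then w (minn `|x| `|y|) else 0.

(** Normalization dictates this value. The test excludes [0], where [0.-1 = 0] would count [w 0]
    twice. *)
Definition halfline_vw (x : int) : R :=
  w `|x| + (if 0 < x then w `|x|.-1 else 0).

Let adj_sym : symmetric halfline_adj.
Proof. by move=> x y; rewrite /halfline_adj orbC andbCA. Qed.

Let adj_irr : irreflexive halfline_adj.
Proof. by move=> x; rewrite /halfline_adj; lia. Qed.

Let V : set int := [set n : int | 0 <= n].

Let adj_vert x y : halfline_adj x y -> V x /\ V y.
Proof. by case/and3P. Qed.

Let adj_finite x : V x -> finite_set [set y | halfline_adj x y].
Proof.
move=> _; apply: (@sub_finite_set _ _ [set x - 1; x + 1]) => [y /=|]; last first.
  by rewrite finite_setU; split.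
by rewrite /halfline_adj => /and3P[_ _ /orP[/eqP|/eqP]]; [right|left]; lia.
Qed.

(** Any two vertices are joined through [0]. *)
Let adj_connected x y : V x -> V y ->
  exists2 p : seq int, path halfline_adj x p & last x p = y.
Proof.
case: x y => [x|//] [y|//] _ _.
have [p Pp Lp] : exists2 p, path halfline_adj x%:Z p & last x%:Z p = 0.
  elim: x => [|x [p Pp Lp]]; first by exists [::].
  by exists (x%:Z :: p) => //=; rewrite Pp andbT /halfline_adj; lia.
have [q Pq Lq] : exists2 q, path halfline_adj 0 q & last 0 q = y%:Z.
  elim: y => [|y [q Pq Lq]]; first by exists [::].
  exists (rcons q y.+1%:Z); rewrite ?last_rcons // rcons_path Pq Lq /halfline_adj.
  lia.
by exists (p ++ q); rewrite ?cat_path ?last_cat ?Lp ?Pp.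
Qed.

Let vw_gt0 x : V x -> 0 < halfline_vw x.
Proof. by move=> _; rewrite ltr_wpDr //; case: ifP => // _; apply: ltW. Qed.

Let ew_gt0 x y : halfline_adj x y -> 0 < halfline_ew x y.
Proof. by rewrite /halfline_ew => ->. Qed.

Let ew_eq0 x y : ~~ halfline_adj x y -> halfline_ew x y = 0.
Proof. by rewrite /halfline_ew => /negbTE->. Qed.

Let ew_sym x y : halfline_ew x y = halfline_ew y x.
Proof. by rewrite /halfline_ew adj_sym minnC. Qed.

Definition halfline : wgraph R int :=
  WGraph adj_vert adj_sym adj_irr adj_finite adj_connected
    vw_gt0 ew_gt0 ew_eq0 ew_sym.

Lemma halfline_linear : linear_graph halfline.
Proof.
split.
  exists `[0, +oo[; apply/seteqP; split => n /=;
    by rewrite in_itv /= andbT ler0z.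
move=> n k /=; rewrite /halfline_adj; split.
  by case/and3P => n0 k0 /orP[/eqP|/eqP] E; split => //; [left|right].
by case=> n0 k0 E; rewrite n0 k0 /=; apply/orP; case: E => ->; [left|right].
Qed.

Lemma halfline_inf : (inf_vert halfline <= 0)%E.
Proof. by apply: ereal_inf_lbound; exists 0. Qed.

Lemma halfline_sup : sup_vert halfline = +oo%E.
Proof.
apply: eq_infty => r; have rn := ltW (truncnS_gt r).
apply: (@le_trans _ _ (((Num.truncn r).+1%:Z%:~R : R)%:E)); first by rewrite lee_fin.
by apply: ereal_sup_ubound; exists (Num.truncn r).+1%:Z.
Qed.

Lemma halfline_ewS (i : nat) : eweight halfline i%:Z (i%:Z + 1) = w i.
Proof.
rewrite /= /halfline_ew ifT; first by congr w; lia.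
by rewrite /halfline_adj; lia.
Qed.

Lemma halfline_normalized : normalized halfline.
Proof.
move=> [i|//] _; rewrite /= /halfline_vw.
have := linear_sum_adj halfline_linear i%:Z (fun=> 1); rewrite !mulr1 => E.
transitivity (eweight halfline i (i%:Z - 1) + eweight halfline i (i%:Z + 1)).
  rewrite halfline_ewS addrC; congr (_ + _).
  case: i {E} => [|i] //=; have -> : i.+1%:Z - 1 = i%:Z by lia.
  rewrite -[RHS]/(eweight halfline i.+1%:Z i%:Z) eweight_sym.
  by rewrite -addn1 PoszD halfline_ewS.
by rewrite -E; apply: eq_fsbigr => y _; rewrite mulr1.
Qed.

End HalfLine.

(** * The half-line attaining the extremal drift *)

Section ExtremalGraph.
Variables (R : realType) (k : R).
Hypothesis k1 : 1 <= k.

Let k0 : 0 < k. Proof. exact: lt_le_trans k1. Qed.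

Let e := extremal_drift k.

(** The two edges at vertex [j.+1] have weights in the ratio of [dplus] to [dminus] for drift
    [e j.+1]. At [0], the value [e 0 = 1 / 2] agrees with [dplus = 1] at an endpoint. *)
Fixpoint extremal_weight (i : nat) : R :=
  if i is j.+1 then
    extremal_weight j * ((2^-1 + e j.+1) / (2^-1 - e j.+1))
  else 1.

Lemma extremal_weight_gt0 i : 0 < extremal_weight i.
Proof.
elim: i => [|i IH] //=; rewrite mulr_gt0 // divr_gt0 ?subr_gt0 ?extremal_drift_lt //.
by rewrite addr_gt0 // extremal_drift_gt0.
Qed.

Definition extremal_graph := halfline extremal_weight_gt0.

Lemma extremal_dplus (i : nat) : dplus extremal_graph i%:Z = 2^-1 + e i.
Proof.
rewrite /dplus halfline_ewS /= /halfline_vw /=.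
case: i => [|i] /=.
  by rewrite /e /extremal_drift !addr0; field; rewrite lt0r_neq0.
have := extremal_drift_lt k0 i; rewrite -/e => ei.
have w0 := extremal_weight_gt0 i; have ep := extremal_drift_gt0 k0 i.+1.
rewrite -/e in ep; move: (extremal_weight i) (e i.+1) ei w0 ep => w x ei w0 ep.
by field; repeat (apply/andP; split); apply: lt0r_neq0; lra.
Qed.

(** At [0] the curvature form vanishes identically, as [2 * e 1 = th]. At an interior vertex its
    discriminant vanishes by [extremal_drift_step] and its leading coefficient is positive. *)
Lemma extremal_graph_CD : CD extremal_graph 0 (2 * k + 2)%:E.
Proof.
move=> [i|//] _.
have linG := halfline_linear extremal_weight_gt0.
have normG := @halfline_normalized R _ extremal_weight_gt0.
have thE : 1 - 2 / (2 * k + 2) = k / (k + 1).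
  by have kp := k0; field; apply/andP; split; apply: lt0r_neq0; lra.
apply: curvature_form_CD_at => // a b.
have mE (j : nat) : dminus extremal_graph j%:Z = 2^-1 - e j.
  have -> : dminus extremal_graph j%:Z = 1 - dplus extremal_graph j%:Z.
    by rewrite -(dminus_dplus1 linG normG (n := j%:Z)) ?addrK.
  by rewrite extremal_dplus; lra.
have sE (j : nat) : j%:Z + 1 = j.+1%:Z by lia.
case: i => [|i].
  have d0 : dminus extremal_graph 0%:Z = 0 by apply: dminus_eq0.
  rewrite curvature_form_drift //; last by right.
  rewrite d0 extremal_dplus sE extremal_dplus thE.
  rewrite le_eqVlt; apply/orP; left; apply/eqP.
  rewrite /e /extremal_drift; have kp := k0.
  by field; repeat (apply/andP; split); apply: lt0r_neq0; lra.
rewrite curvature_form_drift //; last by left.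
have -> : i.+1%:Z - 1 = i%:Z by lia.
rewrite sE !extremal_dplus mE thE.
have S := extremal_drift_step k0 i; rewrite /= -/e in S.
have e0 := extremal_drift_gt0 k0 i; have e1 := extremal_drift_gt0 k0 i.+1.
have el := extremal_drift_lt k0 i.
rewrite -/e in e0 e1 el.
set th := k / (k + 1) in S *.
have th0 : 0 < th by rewrite divr_gt0 // ltr_wpDr.
move: (e i) (e i.+1) (e i.+2) S e0 e1 el => x y z S e0 e1 el.
have r0 : 0 < 2^-1 - y by rewrite subr_gt0.
have A0 : 0 < (2^-1 - y) * (th * (2^-1 - y) + 2 * x).
  by apply: mulr_gt0 => //; apply: addr_gt0; apply: mulr_gt0.
have disc : (th * (2^-1 + y) * (2^-1 - y)) ^+ 2 <=
    (2^-1 - y) * (th * (2^-1 - y) + 2 * x) *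
    ((2^-1 + y) * (th * (2^-1 + y) - 2 * z)).
  rewrite -subr_ge0; have -> : (2^-1 - y) * (th * (2^-1 - y) + 2 * x) *
      ((2^-1 + y) * (th * (2^-1 + y) - 2 * z)) -
      (th * (2^-1 + y) * (2^-1 - y)) ^+ 2 = 2 * (2^-1 - y) * (2^-1 + y) *
      (th * ((2^-1 + y) * x - (2^-1 - y) * z) - 2 * x * z) by ring.
  by rewrite S subrr mulr0.
have Q := quadratic_form_ge0 A0 disc a b.
apply: mulr_ge0 => //; move: Q; congr (0 <= _); ring.
Qed.

Lemma extremal_growth i :
  vweight extremal_graph i.+1%:Z / vweight extremal_graph i%:Z = growth_factor k i.
Proof.
have linG := halfline_linear extremal_weight_gt0.
have normG := @halfline_normalized R _ extremal_weight_gt0.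
have V (j : nat) : vert extremal_graph j%:Z by [].
have sE : i%:Z + 1 = i.+1%:Z by lia.
have := @eweight_dplus_dminus _ extremal_graph i%:Z (V i).
rewrite sE => /(_ (V _)).
have := dminus_dplus1 linG normG (V i.+1); rewrite !extremal_dplus => E.
have {E} -> : dminus extremal_graph i.+1%:Z = 2^-1 - e i.+1 by lra.
have := extremal_drift_lt k0 i; rewrite -/e => el.
have m0 := lt0r_neq0 (vweight_gt0 (V i)).
rewrite -growth_factor_drift // -/e mulrC => mE.
apply/eqP; rewrite eqr_div //; last by rewrite gt_eqF // subr_gt0.
by rewrite mulrC -mE mulrC.
Qed.

End ExtremalGraph.

(** * Drift, monotonicity and growth on a general graph *)

Section GrowthOfLinearGraph.
Variables (R : realType) (D : R) (G : wgraph R int).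
Hypotheses (D4 : 4 <= D) (normG : normalized G) (linG : linear_graph G).
Hypotheses (infG : (inf_vert G <= 0)%E) (supG : sup_vert G = +oo%E).
Hypothesis CDG : CD G 0 D%:E.

Lemma vert_upward n k : vert G n -> n <= k -> vert G k.
Proof.
have [[I VI] _] := linG => Vn nk.
have : ((k%:~R : R)%:E < sup_vert G)%E by rewrite supG ltry.
move=> /ereal_sup_gt[_ [l Vl <-]]; rewrite lte_fin => kl.
rewrite VI /= in Vn Vl *.
by apply: (interval_is_interval Vn Vl); rewrite ler_int nk ltW.
Qed.

Lemma vert_nat (i : nat) : vert G i%:Z.
Proof.
(* A strict bound yields an actual vertex, and an integer below [1] is at most [0]. *)
have : (inf_vert G < 1)%E by rewrite (le_lt_trans infG) // lte01.
move=> /ereal_inf_lt[_ [l Vl <-]]; rewrite lte_fin -[1]/(1%:~R) ltr_int => l1.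
by apply: vert_upward Vl _; lia.
Qed.

Let th := 1 - 2 / D.

Let D0 : 0 < D. Proof. by apply: lt_le_trans D4. Qed.

Let th0 : 0 < th.
Proof.
by rewrite /th subr_gt0 ltr_pdivrMr // mul1r; apply: lt_le_trans D4; rewrite ltr_nat.
Qed.

Let th1 : th < 1. Proof. by rewrite /th gtrBl divr_gt0. Qed.

Let vert_succ n : vert G n -> vert G (n + 1).
Proof. by move/vert_upward; apply; rewrite lerDl. Qed.

Section Drift.
Variable a : int.
Hypothesis Va : vert G a.

Let Vai (i : nat) : vert G (a + i%:Z).
Proof. by apply: vert_upward Va _; rewrite lerDl. Qed.

(** The drift read to the right from an arbitrary vertex [a]: [drift_ge0] speaks of index [0] only,
    and varying [a] reaches every vertex. *)
Let p i := dplus G (a + i%:Z) - 2^-1.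

Let succE (i : nat) : a + i.+1%:Z = a + i%:Z + 1. Proof. by lia. Qed.
Let predE (i : nat) : a + i.+1%:Z - 1 = a + i%:Z. Proof. by lia. Qed.

Let dminusE i : dminus G (a + i%:Z) = 2^-1 - p i.
Proof. by have := dminus_dplus1 linG normG (Vai i); rewrite /p; lra. Qed.

Lemma drift_gtN i : - 2^-1 < p i.
Proof. by rewrite /p ltrBrDr addNr; apply: dplus_gt0 => //; apply: vert_succ. Qed.

Lemma drift_lt i : p i.+1 < 2^-1.
Proof.
rewrite -subr_gt0 -dminusE; apply: dminus_gt0 => //; first by rewrite predE.
Qed.

Lemma drift_left i : 0 <= th * (2^-1 - p i.+1) + 2 * p i.
Proof.
rewrite -dminusE /p -(predE i); apply: CD_drift_left => //; first by apply: CDG.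
  by rewrite predE.
exact: vert_succ.
Qed.

Lemma drift_step i : 2 * p i * p i.+2 <=
  th * ((2^-1 + p i.+1) * p i - (2^-1 - p i.+1) * p i.+2).
Proof.
rewrite -dminusE.
have -> : 2^-1 + p i.+1 = dplus G (a + i.+1%:Z) by rewrite /p; lra.
rewrite /p -(predE i) (succE i.+1); apply: CD_drift_step => //; first by apply: CDG.
  by rewrite predE.
exact: vert_succ.
Qed.

Lemma drift_base_ge0 : 0 <= dplus G a - 2^-1.
Proof.
have := drift_ge0 th0 th1 drift_gtN drift_left drift_step.
by rewrite /p addr0.
Qed.

Lemma drift_right i : 2 * p i.+1 <= th * (2^-1 + p i).
Proof.
have -> : 2^-1 + p i = dplus G (a + i%:Z) by rewrite /p; lra.
rewrite /p succE; apply: CD_drift_right => //; first by apply: CDG.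
exact: vert_succ.
Qed.

End Drift.

Lemma vweight_step n : vert G n ->
  vweight G (n + 1) = vweight G n * (dplus G n / dminus G (n + 1)).
Proof.
move=> Vn; have Vn1 := vert_succ Vn.
have r0 : 0 < dminus G (n + 1) by apply: dminus_gt0 => //; rewrite addrK.
rewrite mulrA [_ * dplus _ _]mulrC eweight_dplus_dminus // [_ * vweight _ _]mulrC.
by rewrite mulfK // gt_eqF.
Qed.

(** Each ratio is [dplus] at a vertex over [dminus] at the next; nonnegative drift puts the former
    at or above [1 / 2] and the latter at or below. *)
Lemma vweight_nondecreasing n k :
  vert G n -> n <= k -> vweight G n <= vweight G k.
Proof.
move=> Vn nk; have [i ->] : exists i : nat, k = n + i%:Z.
  by exists `|k - n|%N; lia.
elim: i => [|i IH]; first by rewrite addr0.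
apply: le_trans IH _; have Vi : vert G (n + i%:Z) by apply: vert_upward Vn _; lia.
have Vi1 := vert_succ Vi.
have -> : n + i.+1%:Z = n + i%:Z + 1 by lia.
rewrite vweight_step // ler_peMr ?(ltW (vweight_gt0 Vi)) //.
rewrite ler_pdivlMr ?mul1r; last by apply: dminus_gt0 => //; rewrite addrK.
have := drift_base_ge0 Vi; have := drift_base_ge0 Vi1.
by have := dminus_dplus1 linG normG Vi1; lra.
Qed.

Let k := (D - 2) / 2.
Let k1 : 1 <= k. Proof. by rewrite /k; have d4 := D4; lra. Qed.
Let k0 : 0 < k. Proof. exact: lt_le_trans k1. Qed.

Let thE : th = k / (k + 1).
Proof.
rewrite /th /k; have d4 := D4.
by field; repeat (apply/andP; split); apply: lt0r_neq0; lra.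
Qed.

Lemma drift_le (i : nat) : dplus G i%:Z - 2^-1 <= extremal_drift k i.
Proof.
rewrite -[i%:Z]add0r.
have V0 := vert_nat 0; have p_le : dplus G 0 - 2^-1 <= 2^-1.
  by have := dminus_dplus1 linG normG V0; have := dminus_ge0 V0; lra.
apply: (drift_le_extremal k0 (p := fun i : nat => dplus G (0 + i%:Z) - 2^-1)) => //.
- by move=> n; rewrite add0r; apply: drift_base_ge0; apply: vert_nat.
- exact: (drift_lt V0).
(* The second initial value: [2 * p 1 <= th * (2^-1 + p 0) <= th]. *)
- rewrite -thE ler_pdivlMr // mulrC; apply: le_trans (drift_right V0 0) _.
  by rewrite addr0 ler_piMr ?(ltW th0) //; lra.
- by rewrite -thE; apply: (drift_step V0).
Qed.

Lemma vweight_growth_factor (i : nat) :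
  vweight G i.+1%:Z <= vweight G i%:Z * growth_factor k i.
Proof.
have Vi := vert_nat i; have Vi1 := vert_nat i.+1.
have sE : i%:Z + 1 = i.+1%:Z by lia.
rewrite -sE vweight_step // sE ler_pM2l ?vweight_gt0 // -growth_factor_drift //.
have h0 := drift_le i; have h1 := drift_le i.+1.
have el := extremal_drift_lt k0 i; have q0 := drift_base_ge0 Vi.
have rE := dminus_dplus1 linG normG Vi1.
have rq : 2^-1 - extremal_drift k i.+1 <= dminus G i.+1%:Z by lra.
apply: ler_pM; [lra | by rewrite invr_ge0 dminus_ge0 | lra | ].
rewrite lef_pV2 ?posrE ?subr_gt0 //.
by apply: lt_le_trans rq; rewrite subr_gt0.
Qed.

(** The one-step bounds telescope, since the bases [(m + 2) / (m + 1)] multiply to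
    [(j + 1) / (i + 1)]. *)
Lemma linear_growth_bound (i j : nat) : (i <= j)%N -> growth_bound G D i j.
Proof.
rewrite /growth_bound; have -> : D - 2 = 2 * k by rewrite /k; field.
move=> ij; rewrite -(subnKC ij); elim: (j - i)%N => [|l IH].
  rewrite addn0 !divff ?powR1 //; last exact: lt0r_neq0 (vweight_gt0 (vert_nat i)).
rewrite addnS; set m := (i + l)%N in IH *.
have -> : m.+2%:R / i.+1%:R = (m.+1%:R / i.+1%:R) * (m.+2%:R / m.+1%:R) :> R.
  by rewrite [RHS]mulrC mulrA divfK ?pnatr_eq0.
rewrite powRM ?divr_ge0 //.
have mi0 := vweight_gt0 (vert_nat i); have mm0 := vweight_gt0 (vert_nat m).
apply: (@le_trans _ _ (vweight G m%:Z / vweight G i%:Z * growth_factor k m)).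
  by rewrite mulrAC ler_pM2r ?invr_gt0 // vweight_growth_factor.
apply: ler_pM => //; [by rewrite divr_ge0 // ltW | | exact: growth_factor_le].
have e0 := extremal_drift_gt0 k0 m; have e1 := extremal_drift_lt k0 m.
by rewrite -growth_factor_drift //; apply: divr_ge0; lra.
Qed.

End GrowthOfLinearGraph.

Theorem theorem1p9 (R : realType) :
  (forall (D : R) (G : wgraph R int),
     4 <= D ->
     normalized G -> linear_graph G ->
     (inf_vert G <= 0)%E -> sup_vert G = +oo%E ->
     CD G 0 D%:E ->
     [/\ forall i j : nat, (i < j)%N -> growth_bound G D i j,
         forall n : int, vert G n -> 0 <= dplus G n - 2^-1
       & forall n k : int, vert G n -> vert G k -> n <= k ->
           vweight G n <= vweight G k]) /\
  (forall D D' : R, 4 <= D -> D' < D ->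
     exists G : wgraph R int,
       [/\ normalized G, linear_graph G,
           (inf_vert G <= 0)%E, sup_vert G = +oo%E & CD G 0 D%:E] /\
       exists i j : nat, (i < j)%N /\ ~ growth_bound G D' i j).
Proof.
split=> [D G D4 normG linG infG supG CDG|D D' D4 D'D].
  split=> [i j ij|n Vn|n k Vn _ nk].
  - exact: (linear_growth_bound D4 normG linG infG supG CDG (ltnW ij)).
  - exact: (drift_base_ge0 D4 normG linG infG supG CDG Vn).
  - exact: (vweight_nondecreasing D4 normG linG infG supG CDG Vn nk).
(* [2 * k] is the optimal exponent [D - 2]; the bound with [D' - 2 < 2 * k] already fails between
   two consecutive vertices. *)
pose k : R := (D - 2) / 2; have k1 : 1 <= k by rewrite /k; lra.
exists (extremal_graph k1); split.
  have -> : D = 2 * k + 2 by rewrite /k; field.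
  split; [exact: halfline_normalized | exact: halfline_linear | exact: halfline_inf
    | exact: halfline_sup | exact: extremal_graph_CD].
have [n gn] : exists n : nat, (n.+2%:R / n.+1%:R) `^ (D' - 2) < growth_factor k n.
  by apply: growth_factor_gt => //; rewrite /k; lra.
exists n, n.+1; split => //; rewrite /growth_bound extremal_growth.
by apply/negP; rewrite -ltNge.
Qed.
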